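(* Let $a_n$ ($n\ge1$) be the coefficients in the expansion $W(e^t)=\omega_0+\sum_{n=1}^\infty a_nt^n$ about $t=0$. Define a sequence $(c_n)_{n\ge1}$ by $$c_1=-\frac{1}{1+\omega_0},\qquad c_n=-\frac{1}{n(1+\omega_0)}\left((n-1)c_{n-1}+\sum_{k=1}^{n-1}k\,c_k\,c_{n-k}\right),\quad n=2,3,4,\dots$$ Then $a_1=1+c_1$ and $a_n=c_n$ for $n\ge2$.
   Context: $W$ is the principal branch of the Lambert $W$ function and $\omega_0=W(1)$. *)

(* Defs.v *)
(* Stdlib reals with Coquelicot's complex numbers. *)
From Stdlib Require Import Reals.
From Coquelicot Require Import Coquelicot.

Open Scope R_scope.

Definition Cexp (z : C) : C :=
  (exp (Re z) * cos (Im z), exp (Re z) * sin (Im z)).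

(* The range of the principal branch, with the usual convention: the branch
   cut is ]-oo, -1/e], and the values on it are limits from above.  The boundary
   of the range is the curve x = - y cot y (-PI < y < PI), which passes through
   -1 at y = 0; its closed upper half, -1 included, is the image of the cut and
   belongs to the range, its lower half does not. *)
Definition principal_range (w : C) : Prop :=
  (Im w = 0 /\ -1 <= Re w)
  \/ (0 < Im w < PI /\ - Im w * (cos (Im w) / sin (Im w)) <= Re w)
  \/ (- PI < Im w < 0 /\ - Im w * (cos (Im w) / sin (Im w)) < Re w).

(* The principal branch: the unique w in the principal range with w e^w = z. *)
Definition LambertW (z : C) : C :=
  @iota C_CompleteNormedModule
    (fun w : C => (w * Cexp w)%C = z /\ principal_range w).

Definition omega0 : C := LambertW (RtoC 1).

(* Main.v *)
Require Import Defs.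
From Stdlib Require Import Reals.
From Coquelicot Require Import Coquelicot.
From Stdlib Require Import Lra Lia Arith.

(** The recurrence describes the function g(t) = W(e^t) - t rather than W(e^t):
    subtracting t changes only the linear coefficient, which accounts for the
    exceptional relation a_1 = 1 + c_1.  Since w = W(e^t) satisfies w e^w = e^t,
    the function g satisfies (t + g) e^g = 1.  Differentiating and cancelling e^g
    gives g' (1 + t + g) = -1.  With g = omega0 + h, h = sum_(n >= 1) d_n t^n,
    this reads (1 + omega0) h' + t h' + h' h = -1, and comparing coefficients
    yields (1 + omega0) d_1 = -1 and, for n >= 2,
      n (1 + omega0) d_n + (n - 1) d_(n-1) + sum_(0 < k < n) k d_k d_(n-k) = 0,
    which is the recurrence that defines c ([lambert_series_recurrence]).

    A power series is determined by its values on a real interval, so the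
    expansion is used for real t only.  There W(e^t) is the unique positive real
    root of x e^x = e^t ([LambertW_exp_real]): for a positive value of w e^w the
    principal range contains no non-real w ([principal_range_preimage_real]).
    Taking imaginary parts shows that the a_n are real, and real parts give the
    real series to which the argument above applies. *)

(** * The principal branch on the positive half-line *)

Lemma Cexp_RtoC (t : R) : Cexp (RtoC t) = RtoC (exp t).
Proof.
unfold Cexp; simpl; rewrite cos_0, sin_0; unfold RtoC; f_equal; ring.
Qed.

Lemma mul_exp_increasing (x y : R) :
  0 <= x -> x < y -> x * exp x < y * exp y.
Proof.
intros Hx Hxy.
generalize (exp_increasing x y Hxy) (exp_pos x); intros; nra.
Qed.

Lemma mul_exp_surjective (z : R) : 0 < z -> exists x, 0 < x /\ x * exp x = z.
Proof.
intros Hz.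
(* z e^z > z, so the root lies between 0 and z. *)
destruct (IVT (fun x => x * exp x - z) 0 z) as [x [[Hx0 _] Hx]]; try lra.
- apply derivable_continuous; auto with real.
  apply derivable_minus; [|apply derivable_const].
  apply derivable_mult; [apply derivable_id|apply derivable_exp].
- generalize (exp_ineq1 z); intros; nra.
- exists x; split; [|lra].
  destruct (Rle_lt_or_eq_dec 0 x Hx0) as [|E]; [assumption|].
  subst x; lra.
Qed.

(** If w = x + i y has y <> 0 and w e^w is real, then x sin y + y cos y = 0, so w
    lies on the boundary curve x = - y cot y.  Its lower half is excluded from
    the range; on its upper half w e^w = - e^x y / sin y is negative. *)
Lemma principal_range_preimage_real (w : C) (z : R) :
  0 < z -> (w * Cexp w)%C = RtoC z -> principal_range w -> Im w = 0.
Proof.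
destruct w as [x y]; intros Hz Hw Hr.
unfold Cexp, Cmult, RtoC in Hw; simpl in Hw.
injection Hw as HRe HIm.
assert (Hcot : forall s : R, s <> 0 -> sin y = s -> x = - y * (cos y / s)).
{ intros s Hs <-.
  apply (Rmult_eq_reg_r (exp x * sin y)).
  - field_simplify; [nra|assumption].
  - apply Rmult_integral_contrapositive; split; [|assumption].
    generalize (exp_pos x); lra. }
unfold principal_range in Hr; simpl in Hr |- *.
destruct Hr as [[Hy _]|[[[Hy1 Hy2] Hxy]|[[Hy1 Hy2] Hxy]]]; [assumption| |].
- exfalso.
  assert (Hs := sin_gt_0 y Hy1 Hy2).
  assert (Hx := Hcot (sin y) ltac:(lra) eq_refl).
  assert (E : z * sin y = - (exp x * y)).
  { transitivity (- (exp x * y) * (Rsqr (sin y) + Rsqr (cos y))).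
    - rewrite <- HRe; unfold Rsqr.
      assert (Hxs : x * sin y = - y * cos y) by (rewrite Hx; field; lra).
      transitivity ((x * sin y) * (exp x * cos y) - y * exp x * sin y * sin y);
        [ring|rewrite Hxs; ring].
    - rewrite sin2_cos2; ring. }
  generalize (exp_pos x); intros; nra.
- exfalso.
  assert (Hs : sin y < 0).
  { generalize (sin_gt_0 (- y) ltac:(lra) ltac:(lra)); rewrite sin_neg; lra. }
  assert (Hx := Hcot (sin y) ltac:(lra) eq_refl); lra.
Qed.

Lemma LambertW_mul_exp (x : R) :
  0 < x -> LambertW (RtoC (x * exp x)) = RtoC x.
Proof.
intros Hx; unfold LambertW.
assert (Hz : 0 < x * exp x) by (generalize (exp_pos x); nra).
apply (@iota_unique _ C_CompleteNormedModule).
- intros w [Hw Hr].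
  assert (Hy := principal_range_preimage_real w _ Hz Hw Hr).
  destruct w as [u v]; simpl in Hy; subst v.
  change (u, 0) with (RtoC u) in *.
  rewrite Cexp_RtoC, <- RtoC_mult in Hw; apply RtoC_inj in Hw.
  assert (Hu : 0 < u) by (generalize (exp_pos u); nra).
  f_equal; destruct (Rtotal_order u x) as [H|[H|H]]; [|assumption|].
  + generalize (mul_exp_increasing u x); lra.
  + generalize (mul_exp_increasing x u); lra.
- split.
  + now rewrite Cexp_RtoC, <- RtoC_mult.
  + left; simpl; lra.
Qed.

Lemma LambertW_exp_real (t : R) :
  exists x, 0 < x /\ x * exp x = exp t /\ LambertW (Cexp (RtoC t)) = RtoC x.
Proof.
destruct (mul_exp_surjective (exp t) (exp_pos t)) as [x [Hx E]].
exists x; repeat split; [assumption..|].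
now rewrite Cexp_RtoC, <- E, LambertW_mul_exp.
Qed.

(** * Real power series *)

(** Working on a whole interval makes the positive radius of convergence, which
    termwise differentiation and multiplication require, automatic. *)
Definition sums_to (a : nat -> R) (r : R) (f : R -> R) : Prop :=
  forall t, Rabs t < r -> is_pseries a t (f t).

(** The terms at any point strictly between |t| and r tend to 0, so the radius of
    convergence is at least the modulus of that point. *)
Lemma sums_to_radius (a : nat -> R) (r : R) (f : R -> R) (t : R) :
  sums_to a r f -> Rabs t < r -> Rbar_lt (Rabs t) (CV_radius a).
Proof.
intros Ha Ht.
set (x := (Rabs t + r) / 2).
assert (Hx : 0 <= x < r) by (unfold x; generalize (Rabs_pos t); lra).
assert (Hax : Rabs x = x) by (apply Rabs_pos_eq; lra).
apply Rbar_lt_le_trans with (Rabs x).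
- rewrite Hax; unfold x; simpl; lra.
- apply Rbar_not_lt_le; intros H.
  apply (CV_disk_outside _ _ H), ex_series_lim_0.
  apply ex_pseries_R; eexists; apply Ha; rewrite Hax; lra.
Qed.

Lemma sums_to_unique (a b : nat -> R) (r : R) (f : R -> R) (n : nat) :
  0 < r -> sums_to a r f -> sums_to b r f -> a n = b n.
Proof.
intros Hr Ha Hb.
assert (H0 : Rabs 0 < r) by (rewrite Rabs_R0; assumption).
apply PSeries_ext_recip.
- rewrite <- Rabs_R0; apply (sums_to_radius _ _ _ _ Ha H0).
- rewrite <- Rabs_R0; apply (sums_to_radius _ _ _ _ Hb H0).
- exists (mkposreal r Hr); intros t Ht.
  assert (Ht' : Rabs t < r).
  { replace t with (t - 0) by ring; exact Ht. }
  rewrite (is_pseries_unique _ _ _ (Ha t Ht')).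
  now rewrite (is_pseries_unique _ _ _ (Hb t Ht')).
Qed.

Definition monomial (c : R) (j n : nat) : R := if Nat.eqb n j then c else 0.

Lemma is_pseries_monomial (c : R) (j : nat) (x : R) :
  is_pseries (monomial c j) x (c * x ^ j).
Proof.
apply is_pseries_R.
change (is_lim_seq (sum_n (fun k => monomial c j k * x ^ k)) (c * x ^ j)).
apply is_lim_seq_ext_loc with (fun _ => c * x ^ j); [|apply is_lim_seq_const].
assert (Hlt : forall n, (n < j)%nat ->
  sum_n (fun k => monomial c j k * x ^ k) n = 0).
{ induction n as [|n IH]; intros Hn.
  - rewrite sum_O; unfold monomial.
    destruct (Nat.eqb_spec 0 j); [lia|].
    change (0 * x ^ 0 = 0); ring.
  - rewrite sum_Sn, IH by lia; unfold monomial.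
    destruct (Nat.eqb_spec (S n) j); [lia|].
    change (0 + 0 * x ^ S n = 0); ring. }
exists j; intros n Hn; symmetry; induction Hn as [|n Hn IH].
- destruct j as [|j].
  + rewrite sum_O; reflexivity.
  + rewrite sum_Sn, Hlt by lia; unfold monomial.
    rewrite Nat.eqb_refl; apply Rplus_0_l.
- rewrite sum_Sn, IH; unfold monomial at 1.
  destruct (Nat.eqb_spec (S n) j); [lia|].
  change (c * x ^ j + 0 * x ^ S n = c * x ^ j); ring.
Qed.

(** Differentiating (t + g) e^g = 1 with g = omega + h, then cancelling e^g, gives
    (1 + omega) h' + t h' + h' h = -1; the two conclusions are its coefficients
    of t^0 and t^n. *)
Lemma lambert_series_recurrence (d : nat -> R) (r omega : R) (h : R -> R) :
  0 < r -> d 0%nat = 0 -> sums_to d r h ->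
  (forall t, Rabs t < r -> (t + omega + h t) * exp (omega + h t) = 1) ->
  (1 + omega) * d 1%nat = -1 /\
  forall n, (1 <= n)%nat ->
    INR (S n) * (1 + omega) * d (S n) + INR n * d n
    + sum_n_m (fun k => INR k * d k * d (S n - k)%nat) 1 n = 0.
Proof.
intros Hr Hd0 Hd Heq.
(* The coefficients of (1 + omega) h' + t h' + h' h. *)
set (q := PS_plus (PS_plus (PS_scal (1 + omega) (PS_derive d))
                           (PS_incr_1 (PS_derive d)))
                  (PS_mult (PS_derive d) d)).
assert (Hq : forall n, q n = monomial (-1) 0 n).
{ intros n; apply (sums_to_unique q (monomial (-1) 0) r (fun t => -1 * t ^ 0));
    [assumption| |intros t _; apply is_pseries_monomial].
  intros t Ht.
  assert (Hrad := sums_to_radius _ _ _ _ Hd Ht).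
  assert (Hrad' : Rbar_lt (Rabs t) (CV_radius (PS_derive d)))
    by (rewrite CV_radius_derive; assumption).
  set (h' := PSeries (PS_derive d) t).
  assert (Hh' : is_pseries (PS_derive d) t h')
    by (apply PSeries_correct, CV_radius_inside; assumption).
  assert (Hloc : locally t (fun u => Rabs u < r)).
  { assert (He : 0 < r - Rabs t) by lra.
    exists (mkposreal _ He); intros u Hu.
    change (Rabs (u - t) < r - Rabs t) in Hu.
    generalize (Rabs_triang_inv u t); lra. }
  assert (Hder : is_derive h t h').
  { apply is_derive_ext_loc with (PSeries d).
    - apply filter_imp with (2 := Hloc); intros u Hu.
      apply is_pseries_unique, Hd, Hu.
    - apply is_derive_PSeries; assumption. }
  (* The derivative of (t + omega + h) e^(omega + h) at t, known to be 0. *)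
  assert (H0 : ((1 + h') + (t + omega + h t) * h') * exp (omega + h t) = 0).
  { transitivity (Derive (fun u => (u + omega + h u) * exp (omega + h u)) t).
    - symmetry; apply is_derive_unique.
      assert (ex_derive h t) by (eexists; apply Hder).
      auto_derive; [now repeat split|].
      replace (Derive (fun x => h x) t) with h'
        by (symmetry; apply is_derive_unique, Hder).
      ring.
    - rewrite (Derive_ext_loc _ (fun _ => 1)); [apply Derive_const|].
      apply filter_imp with (2 := Hloc); intros u Hu; apply Heq, Hu. }
  (* Cancel the exponential. *)
  replace (-1 * t ^ 0) with ((1 + omega) * h' + t * h' + h' * h t).
  2: { apply Rmult_integral in H0.
       generalize (exp_pos (omega + h t)); destruct H0; simpl; lra. }
  apply (is_pseries_plus (V := R_NormedModule)).
  - apply (is_pseries_plus (V := R_NormedModule)).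
    + apply (is_pseries_scal (V := R_NormedModule)); [apply Rmult_comm|exact Hh'].
    + apply (is_pseries_incr_1 (V := R_NormedModule)); exact Hh'.
  - apply is_pseries_mult; try assumption; apply Hd, Ht. }
split.
- generalize (Hq 0%nat).
  unfold q, PS_plus, PS_scal, PS_incr_1, PS_mult, PS_derive, monomial.
  unfold plus, scal, zero; simpl; unfold mult; simpl; rewrite Hd0; lra.
- intros n Hn; destruct n as [|n]; [lia|].
  transitivity (q (S n)); [|exact (Hq (S n))].
  unfold q, PS_plus, PS_scal, PS_incr_1, PS_mult.
  (* The last term of the convolution vanishes because d 0 = 0. *)
  rewrite tech5, Nat.sub_diag, Hd0, <- sum_n_Reals.
  unfold sum_n; rewrite <- sum_n_m_S.
  unfold PS_derive, plus, scal; simpl; unfold mult; simpl.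
  rewrite Rmult_0_r, Rplus_0_r; f_equal; ring.
Qed.

(** * From complex series to real ones *)

Lemma is_series_Re (u : nat -> C) (s : C) :
  @is_series C_AbsRing C_NormedModule u s -> is_series (fun n => Re (u n)) (Re s).
Proof.
intros H.
assert (E : forall n, Re (@sum_n C_AbelianMonoid u n) = sum_n (fun k => Re (u k)) n).
{ induction n as [|n IH]; [now rewrite !sum_O|].
  now rewrite !sum_Sn, <- IH. }
apply filterlim_ext with (1 := E).
apply filterlim_comp with (1 := H).
destruct s as [x y]; apply continuous_fst.
Qed.

Lemma is_series_Im (u : nat -> C) (s : C) :
  @is_series C_AbsRing C_NormedModule u s -> is_series (fun n => Im (u n)) (Im s).
Proof.
intros H.
assert (E : forall n, Im (@sum_n C_AbelianMonoid u n) = sum_n (fun k => Im (u k)) n).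
{ induction n as [|n IH]; [now rewrite !sum_O|].
  now rewrite !sum_Sn, <- IH. }
apply filterlim_ext with (1 := E).
apply filterlim_comp with (1 := H).
destruct s as [x y]; apply continuous_snd.
Qed.

Lemma is_pseries_from_1 (a : nat -> R) (t l : R) :
  a 0%nat = 0 -> is_series (fun m => a (S m) * t ^ S m) l -> is_pseries a t l.
Proof.
intros Ha0 H; apply is_pseries_R.
apply is_series_decr_1.
replace (plus l _) with l; [exact H|].
unfold plus, opp; simpl; rewrite Ha0; ring.
Qed.

Lemma sum_n_m_RtoC (f : nat -> R) (n m : nat) :
  @sum_n_m C_AbelianMonoid (fun k => RtoC (f k)) n m = RtoC (sum_n_m f n m).
Proof.
destruct (le_lt_dec n m) as [H|H].
- induction H as [|m H IH]; [now rewrite !sum_n_n|].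
  rewrite !sum_n_Sm, IH by lia; symmetry; apply RtoC_plus.
- now rewrite !sum_n_m_zero.
Qed.

(** * The expansion of W(e^t) *)

Theorem mainTheorem14 :
  forall a c : nat -> C,
  (exists r : R, (0 < r)%R /\
     forall t : C, (Cmod t < r)%R ->
       exists s : C,
         @is_series C_AbsRing C_NormedModule
           (fun m : nat => (a (S m) * Cpow t (S m))%C) s
         /\ LambertW (Cexp t) = (omega0 + s)%C) ->
  c 1%nat = (- (1 / (1 + omega0)))%C ->
  (forall n : nat, (2 <= n)%nat ->
     c n = (- (1 / (RtoC (INR n) * (1 + omega0)))
            * (RtoC (INR (n - 1)) * c (n - 1)%nat
               + sum_n_m (fun k : nat =>
                   (RtoC (INR k) * c k * c (n - k)%nat)%C) 1 (n - 1)))%C) ->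
  a 1%nat = (1 + c 1%nat)%C
  /\ (forall n : nat, (2 <= n)%nat -> a n = c n).
Proof.
intros a c [r [Hr Ha]] Hc1 Hc.
assert (Homega : exists omega, 0 < omega /\ omega0 = RtoC omega).
{ destruct (LambertW_exp_real 0) as [x [Hx [_ E]]].
  exists x; split; [assumption|].
  now rewrite Cexp_RtoC, exp_0 in E. }
destruct Homega as [omega [Hpos Homega]]; rewrite Homega in *.
(* The real and imaginary parts of the coefficients, and d, the coefficients of
   W(e^t) - omega - t. *)
set (alpha n := match n with O => 0 | S _ => Re (a n) end).
set (beta n := match n with O => 0 | S _ => Im (a n) end).
set (d := PS_plus alpha (monomial (-1) 1)).
set (h t := Re (LambertW (Cexp (RtoC t))) - omega - t).
assert (Hreal : forall t, Rabs t < r ->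
  is_pseries alpha t (h t + t) /\ is_pseries beta t 0 /\
  (t + omega + h t) * exp (omega + h t) = 1).
{ intros t Ht.
  destruct (Ha (RtoC t)) as [s [Hs Hw]]; [now rewrite Cmod_R|].
  destruct (LambertW_exp_real t) as [x [Hx [Hxe Ex]]].
  unfold h; rewrite Ex in *; change (Re (RtoC x)) with x.
  assert (ERe : Re s = x - omega) by (apply (f_equal Re) in Hw; destruct s; cbn in Hw |- *; lra).
  assert (EIm : Im s = 0) by (apply (f_equal Im) in Hw; destruct s; cbn in Hw |- *; lra).
  repeat split.
  - apply is_pseries_from_1; [reflexivity|].
    replace (x - omega - t + t) with (Re s) by (rewrite ERe; ring).
    apply is_series_ext with (2 := is_series_Re _ _ Hs).
    intros n; rewrite <- RtoC_pow; unfold alpha; destruct (a (S n)) as [u v].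
    change (u * t ^ S n - v * 0 = u * t ^ S n); ring.
  - apply is_pseries_from_1; [reflexivity|].
    rewrite <- EIm.
    apply is_series_ext with (2 := is_series_Im _ _ Hs).
    intros n; rewrite <- RtoC_pow; unfold beta; destruct (a (S n)) as [u v].
    change (u * 0 + v * t ^ S n = v * t ^ S n); ring.
  - replace (t + omega + (x - omega - t)) with x by ring.
    replace (omega + (x - omega - t)) with (x + - t) by ring.
    rewrite exp_plus, <- Rmult_assoc, Hxe, <- exp_plus, Rplus_opp_r.
    apply exp_0. }
assert (Hd : sums_to d r h).
{ intros t Ht.
  replace (h t) with (plus (h t + t) (-1 * t ^ 1))
    by (unfold plus; simpl; ring).
  apply (is_pseries_plus (V := R_NormedModule)).
  - apply Hreal, Ht.
  - apply is_pseries_monomial. }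
assert (Hbeta : forall n, beta n = 0).
{ intros n; apply (sums_to_unique beta (monomial 0 0) r (fun t => 0 * t ^ 0))
    with (n := n) in Hr.
  - rewrite Hr; unfold monomial; now destruct (Nat.eqb n 0).
  - intros t Ht; rewrite Rmult_0_l; apply Hreal, Ht.
  - intros t _; apply is_pseries_monomial. }
destruct (lambert_series_recurrence d r omega h) as [Hd1 Hdn]; try assumption.
{ unfold d, PS_plus, plus, monomial, alpha; simpl; ring. }
{ intros t Ht; apply Hreal, Ht. }
assert (Hom1 : (1 + RtoC omega)%C <> 0).
{ rewrite <- RtoC_plus; intros E; apply RtoC_inj in E; lra. }
(* c and the coefficients d obey the same recurrence, and 1 + omega <> 0 makes its
   solution unique. *)
assert (Hcd : forall n, (1 <= n)%nat -> c n = RtoC (d n)).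
{ induction n as [n IH] using lt_wf_ind; intros Hn.
  destruct n as [|[|n]]; [lia| |].
  - rewrite Hc1; apply (f_equal RtoC) in Hd1.
    change (-1) with (- (1)) in Hd1.
    rewrite RtoC_mult, RtoC_plus, RtoC_opp in Hd1.
    replace (RtoC (d 1%nat)) with ((1 + omega) * d 1%nat / (1 + omega))%C
      by (field; exact Hom1).
    rewrite Hd1; field; exact Hom1.
  - rewrite Hc by lia; replace (S (S n) - 1)%nat with (S n) by lia.
    rewrite IH by lia.
    rewrite (sum_n_m_ext_loc (G := C_AbelianMonoid) _
      (fun k => RtoC (INR k * d k * d (S (S n) - k)%nat))).
    2: { intros k Hk; rewrite !IH by lia; now rewrite !RtoC_mult. }
    rewrite sum_n_m_RtoC.
    assert (Hrec := f_equal RtoC (Hdn (S n) ltac:(lia))).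
    set (S1 := sum_n_m _ _ _) in *.
    set (N := INR (S (S n))) in *.
    assert (HN : RtoC N <> 0).
    { intros E; apply RtoC_inj in E; revert E; apply not_0_INR; lia. }
    rewrite !RtoC_plus, !RtoC_mult, RtoC_plus in Hrec.
    rewrite <- Cplus_assoc in Hrec.
    replace (RtoC (INR (S n)) * d (S n) + S1)%C
      with (- (RtoC N * (1 + omega) * d (S (S n))))%C.
    + field; split; assumption.
    + rewrite <- (Cplus_0_r (- _)), <- Hrec; ring. }
assert (Hreal_a : forall n, a (S n) = RtoC (alpha (S n))).
{ intros n; generalize (Hbeta (S n)); unfold alpha, beta.
  destruct (a (S n)) as [x y]; simpl; intros ->; reflexivity. }
split.
- rewrite Hcd by lia; rewrite Hreal_a, <- RtoC_plus; f_equal.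
  unfold d, PS_plus, plus, monomial; simpl; ring.
- intros n Hn; rewrite Hcd by lia.
  destruct n as [|[|n]]; [lia..|]; rewrite Hreal_a; f_equal.
  unfold d, PS_plus, plus, monomial; simpl; ring.
Qed.
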